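(* Let $D$ be $\mathbb H$ or $\mathbb O$, let $f(x)=x^2+Bx+C$ with $B,C\in D$ have a fixed point $\alpha\in D$, and write $$M=\sqrt{\Re(2\alpha+B)^2+\big(|\Im(\alpha+B)|+|\Im(\alpha)|\big)^2},\qquad m=\sqrt{\Re(2\alpha+B)^2+\big(|\Im(\alpha+B)|-|\Im(\alpha)|\big)^2}.$$ (1) If $M<1$, then $\alpha$ is attracting. (2) If $m>1$, then $\alpha$ is repelling. (3) If $m\le 1$ and $1\le M$, then $\alpha$ is ambivalent.
   Context: $\mathbb H$ is Hamilton's real quaternion algebra and $\mathbb O=\mathbb H\oplus\mathbb H\ell$ is the real octonion division algebra, with multiplication $(q+r\ell)(s+t\ell)=qs-\overline{t}r+(tq+r\overline{s})\ell$ and involution $\overline{q+r\ell}=\overline q-r\ell$. For $z$ in $\mathbb H$ or $\mathbb O$: $\Re(z)=\tfrac12(z+\overline z)\in\mathbb R$, $\Im(z)=z-\Re(z)$, $|z|=\sqrt{z\overline z}$ (the Euclidean norm). Polynomials over $D$ are elements of $D[x]=D\otimes_{\mathbb R}\mathbb R[x]$ ($x$ central). Substitution of $\lambda\in D$ in $f(x)=a_mx^m+\dots+a_0$ is $f(\lambda)=a_m\lambda^m+\dots+a_1\lambda+a_0$. Composition is $f\circ g(x)=a_m(g(x))^m+\dots+a_1g(x)+a_0$, computed in $D[x]$; $f^{\circ1}=f$, $f^{\circ n}=f\circ f^{\circ(n-1)}$. An element $\alpha$ is a fixed point of $f$ if $f^{\circ n}(\alpha)=\alpha$ for every $n\ge1$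 (for monic quadratic $f$ over $\mathbb H$ or $\mathbb O$ this is equivalent to $f(\alpha)=\alpha$). A neighborhood of $\alpha$ is a set containing an open ball centered at $\alpha$. A fixed point $\alpha$ of $f$ is attracting if there exist a neighborhood $S$ of $\alpha$ and a positive real $c<1$ such that $|f(\lambda)-\alpha|<c\,|\lambda-\alpha|$ for every $\lambda\in S\setminus\{\alpha\}$; it is repelling if there exist a neighborhood $S$ of $\alpha$ and a real $c>1$ such that $|f(\lambda)-\alpha|>c\,|\lambda-\alpha|$ for every $\lambda\in S\setminus\{\alpha\}$; it is ambivalent if it is neither attracting nor repelling. *)

(* Defs.v *)
From HB Require Import structures.
From mathcomp Require Import all_boot all_order all_algebra.
From mathcomp Require Import ring.
From mathcomp Require Import classical_sets reals.

Set Implicit Arguments.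
Unset Strict Implicit.
Unset Printing Implicit Defensive.

Import Order.TTheory GRing.Theory Num.Theory.
Local Open Scope ring_scope.
Local Open Scope classical_set_scope.

(* The quaternion and octonion algebras are defined over an arbitrary
   commutative ring K. With K a real field R this gives H and O; with
   K = {poly R} it gives H[x] and O[x], as D (x)_R R[x] is the same algebra
   with scalars extended to R[x] (see coef_dmul and dpoly_sum below). *)

(* Quaternion a b c d stands for a + b i + c j + d k. *)
Record quaternion (K : Type) : Type :=
  Quaternion { q_re : K; q_i : K; q_j : K; q_k : K }.

Section QuaternionRing.
Variable K : comNzRingType.
Implicit Types q r : quaternion K.

Definition tuple_of_quat q := (q_re q, q_i q, q_j q, q_k q).
Definition quat_of_tuple (t : K * K * K * K) :=
  Quaternion t.1.1.1 t.1.1.2 t.1.2 t.2.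
Lemma tuple_of_quatK : cancel tuple_of_quat quat_of_tuple.
Proof. by case. Qed.
HB.instance Definition _ := Choice.copy (quaternion K) (can_type tuple_of_quatK).

Definition quat0 : quaternion K := Quaternion 0 0 0 0.
Definition quat1 : quaternion K := Quaternion 1 0 0 0.
Definition addq q r :=
  Quaternion (q_re q + q_re r) (q_i q + q_i r) (q_j q + q_j r) (q_k q + q_k r).
Definition oppq q := Quaternion (- q_re q) (- q_i q) (- q_j q) (- q_k q).
Definition mulq q r :=
  Quaternion
    (q_re q * q_re r - q_i q * q_i r - q_j q * q_j r - q_k q * q_k r)
    (q_re q * q_i r + q_i q * q_re r + q_j q * q_k r - q_k q * q_j r)
    (q_re q * q_j r - q_i q * q_k r + q_j q * q_re r + q_k q * q_i r)
    (q_re q * q_k r + q_i q * q_j r - q_j q * q_i r + q_k q * q_re r).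
Definition conjq q := Quaternion (q_re q) (- q_i q) (- q_j q) (- q_k q).

Lemma addqA : associative addq.
Proof. by move=> [????] [????] [????]; congr Quaternion => /=; ring. Qed.
Lemma addqC : commutative addq.
Proof. by move=> [????] [????]; congr Quaternion => /=; ring. Qed.
Lemma add0q : left_id quat0 addq.
Proof. by move=> [????]; congr Quaternion => /=; ring. Qed.
Lemma addNq : left_inverse quat0 oppq addq.
Proof. by move=> [????]; congr Quaternion => /=; ring. Qed.
HB.instance Definition _ :=
  GRing.isZmodule.Build (quaternion K) addqA addqC add0q addNq.

Lemma mulqA : associative mulq.
Proof. by move=> [????] [????] [????]; congr Quaternion => /=; ring. Qed.
Lemma mul1q : left_id quat1 mulq.
Proof. by move=> [????]; congr Quaternion => /=; ring. Qed.
Lemma mulq1 : right_id quat1 mulq.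
Proof. by move=> [????]; congr Quaternion => /=; ring. Qed.
Lemma mulqDl : left_distributive mulq addq.
Proof. by move=> [????] [????] [????]; congr Quaternion => /=; ring. Qed.
Lemma mulqDr : right_distributive mulq addq.
Proof. by move=> [????] [????] [????]; congr Quaternion => /=; ring. Qed.
Lemma quat1_neq0 : quat1 != quat0.
Proof. by apply/eqP => -[] /eqP; rewrite oner_eq0. Qed.
HB.instance Definition _ := GRing.Zmodule_isNzRing.Build (quaternion K)
  mulqA mul1q mulq1 mulqDl mulqDr quat1_neq0.

End QuaternionRing.

(* Octonion q r stands for q + r l. *)
Record octonion (K : Type) : Type :=
  Octonion { o_fst : quaternion K; o_snd : quaternion K }.

Section OctonionAlgebra.
Variable K : comNzRingType.
Implicit Types z w : octonion K.

Definition pair_of_oct z := (o_fst z, o_snd z).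
Definition oct_of_pair (p : quaternion K * quaternion K) := Octonion p.1 p.2.
Lemma pair_of_octK : cancel pair_of_oct oct_of_pair.
Proof. by case. Qed.
HB.instance Definition _ := Choice.copy (octonion K) (can_type pair_of_octK).

Definition oct0 : octonion K := Octonion 0 0.
Definition addo z w := Octonion (o_fst z + o_fst w) (o_snd z + o_snd w).
Definition oppo z := Octonion (- o_fst z) (- o_snd z).
Lemma addoA : associative addo.
Proof. by move=> [??] [??] [??]; congr Octonion; apply: addrA. Qed.
Lemma addoC : commutative addo.
Proof. by move=> [??] [??]; congr Octonion; apply: addrC. Qed.
Lemma add0o : left_id oct0 addo.
Proof. by move=> [??]; congr Octonion; apply: add0r. Qed.
Lemma addNo : left_inverse oct0 oppo addo.
Proof. by move=> [??]; congr Octonion; apply: addNr. Qed.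
HB.instance Definition _ :=
  GRing.isZmodule.Build (octonion K) addoA addoC add0o addNo.

Definition mulo z w :=
  let: Octonion q r := z in let: Octonion s t := w in
  Octonion (q * s - conjq t * r) (t * q + r * conjq s).
Definition conjo z := Octonion (conjq (o_fst z)) (- o_snd z).

End OctonionAlgebra.

Variant hurwitz : Set := Hamilton | Cayley.

Definition halg (D : hurwitz) (K : comNzRingType) : zmodType :=
  match D with
  | Hamilton => quaternion K
  | Cayley => octonion K
  end.

Section HurwitzAlgebra.
Variables (D : hurwitz) (K : comNzRingType).

Definition dmul : halg D K -> halg D K -> halg D K :=
  match D return halg D K -> halg D K -> halg D K with
  | Hamilton => @mulq K
  | Cayley => @mulo K
  end.

Definition dconj : halg D K -> halg D K :=
  match D return halg D K -> halg D K with
  | Hamilton => @conjq K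
  | Cayley => @conjo K
  end.

(* The embedding a |-> a * 1 of K, and the coordinate along 1. *)
Definition dscal : K -> halg D K :=
  match D return K -> halg D K with
  | Hamilton => fun a => Quaternion a 0 0 0
  | Cayley => fun a => Octonion (Quaternion a 0 0 0) 0
  end.

Definition dcoord1 : halg D K -> K :=
  match D return halg D K -> K with
  | Hamilton => fun q => q_re q
  | Cayley => fun z => q_re (o_fst z)
  end.

(* Octonion algebras are power-associative, so the bracketing is immaterial. *)
Definition dpow (z : halg D K) (n : nat) : halg D K := iter n (dmul z) (dscal 1).

End HurwitzAlgebra.

Arguments dscal D {K} a.

Notation "x *d y" := (dmul x y) (at level 40, left associativity).

Section HurwitzConj.
Variable K : comNzRingType.

(* z + conj z and z * conj z lie in K, hence are given by their coordinate. *)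
Lemma dadd_conj D (z : halg D K) : z + dconj z = dscal D (dcoord1 (z + dconj z)).
Proof.
case: D z => [[a b c d]|[[a b c d] [a' b' c' d']]] /=.
  by congr Quaternion; rewrite /= ?subrr.
congr Octonion; first by congr Quaternion; rewrite /= ?subrr.
by congr Quaternion; rewrite /= ?subrr.
Qed.

Lemma dmul_conj D (z : halg D K) :
  z *d dconj z = dscal D (dcoord1 (z *d dconj z)).
Proof.
case: D z => [[a b c d]|[[a b c d] [a' b' c' d']]] /=.
  by congr Quaternion; rewrite /=; ring.
by congr Octonion; congr Quaternion; rewrite /=; ring.
Qed.

End HurwitzConj.

Section RealHurwitzAlgebra.
Variables (R : realType) (D : hurwitz).
Implicit Types z : halg D R.

Definition dRe z : R := 2^-1 * dcoord1 (z + dconj z).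
Definition dIm z : halg D R := z - dscal D (dRe z).
Definition dnorm z : R := Num.sqrt (dcoord1 (z *d dconj z)).

End RealHurwitzAlgebra.

Section HurwitzMap.
Variables (D : hurwitz) (K L : comNzRingType) (h : K -> L).

Definition qmap (q : quaternion K) : quaternion L :=
  Quaternion (h (q_re q)) (h (q_i q)) (h (q_j q)) (h (q_k q)).

Definition dmap : halg D K -> halg D L :=
  match D return halg D K -> halg D L with
  | Hamilton => qmap
  | Cayley => fun z => Octonion (qmap (o_fst z)) (qmap (o_snd z))
  end.

End HurwitzMap.

Section HurwitzPoly.
Variables (D : hurwitz) (K : comNzRingType).

Definition dpoly : zmodType := halg D {poly K}.
Implicit Types f g : dpoly.

Definition dpolyC (a : halg D K) : dpoly := dmap polyC a.
Definition dpolyX : dpoly := dscal D 'X.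

(* a_i in f = a_m x^m + ... + a_0 *)
Definition dcoef f (i : nat) : halg D K := dmap (fun p : {poly K} => p`_i) f.

Definition qsize (q : quaternion {poly K}) : nat :=
  maxn (maxn (size (q_re q)) (size (q_i q))) (maxn (size (q_j q)) (size (q_k q))).

(* One more than the degree of f; 0 if f = 0. *)
Definition dsize : dpoly -> nat :=
  match D return halg D {poly K} -> nat with
  | Hamilton => qsize
  | Cayley => fun z => maxn (qsize (o_fst z)) (qsize (o_snd z))
  end.

Definition deval f (lam : halg D K) : halg D K :=
  \sum_(i < dsize f) dcoef f i *d dpow lam i.

Definition dcomp f g : dpoly :=
  \sum_(i < dsize f) dpolyC (dcoef f i) *d dpow g i.

(* The n-fold composite f o ... o f, for n >= 1. *)
Definition dcompn f (n : nat) : dpoly := iter n.-1 (dcomp f) f.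

Definition quadratic (B C : halg D K) : dpoly :=
  dpow dpolyX 2 + dpolyC B *d dpolyX + dpolyC C.

End HurwitzPoly.

Arguments dpolyX D K : clear implicits.

Section HurwitzPolyTheory.
Variables (D : hurwitz) (K : comNzRingType).
Implicit Types f g : dpoly D K.

Let q_sum (L : comNzRingType) (I : Type) (r : seq I) (F : I -> quaternion L) :
  \sum_(i <- r) F i =
  Quaternion (\sum_(i <- r) q_re (F i)) (\sum_(i <- r) q_i (F i))
             (\sum_(i <- r) q_j (F i)) (\sum_(i <- r) q_k (F i)).
Proof.
elim: r => [|i r IHr]; first by rewrite !big_nil.
by rewrite !big_cons IHr; case: (F i).
Qed.

Let o_sum (L : comNzRingType) (I : Type) (r : seq I) (F : I -> octonion L) :
  \sum_(i <- r) F i =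
  Octonion (\sum_(i <- r) o_fst (F i)) (\sum_(i <- r) o_snd (F i)).
Proof.
elim: r => [|i r IHr]; first by rewrite !big_nil.
by rewrite !big_cons IHr; case: (F i).
Qed.

Let qcoef (q : quaternion {poly K}) i := qmap (fun p : {poly K} => p`_i) q.

Let qcoefM q r n :
  qcoef (q * r) n = \sum_(i < n.+1) qcoef q i * qcoef r (n - i).
Proof.
rewrite q_sum /qcoef /qmap /=.
by congr Quaternion; rewrite !(coefB, coefD, coefM) !(sumrB, big_split).
Qed.

Let qcoefB q r n : qcoef (q - r) n = qcoef q n - qcoef r n.
Proof. by congr Quaternion; rewrite /= coefB. Qed.

Let qcoefD q r n : qcoef (q + r) n = qcoef q n + qcoef r n.
Proof. by congr Quaternion; rewrite /= coefD. Qed.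

Let qcoef_conj q n : qcoef (conjq q) n = conjq (qcoef q n).
Proof. by congr Quaternion; rewrite /= coefN. Qed.

Let qcoefM_rev q r n :
  qcoef (q * r) n = \sum_(i < n.+1) qcoef q (n - i) * qcoef r i.
Proof.
rewrite qcoefM (reindex_inj rev_ord_inj); apply: eq_bigr => i _ /=.
by rewrite subSS subKn // -ltnS.
Qed.

(* The product of halg D {poly K} is the convolution product of D[x]. *)
Lemma coef_dmul f g n :
  dcoef (f *d g) n = \sum_(i < n.+1) dcoef f i *d dcoef g (n - i).
Proof.
case: D f g => [f g|[q r] [s t]]; first exact: qcoefM.
rewrite o_sum /dcoef /= -!/(qcoef _ _); congr Octonion.
  rewrite qcoefB qcoefM qcoefM_rev -sumrB; apply: eq_bigr => i _ /=.
  by rewrite qcoef_conj.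
rewrite qcoefD qcoefM_rev qcoefM -big_split; apply: eq_bigr => i _ /=.
by rewrite qcoef_conj.
Qed.

Let dpowX i : dpow (dpolyX D K) i = dscal D 'X^i.
Proof.
elim: i => //= i; rewrite /dpow /= => ->; rewrite exprS.
case: D => /=.
  by congr Quaternion; rewrite /=; ring.
by congr Octonion; congr Quaternion; rewrite /=; ring.
Qed.

Let poly_sum (p : {poly K}) n : (size p <= n)%N ->
  p = \sum_(i < n) (p`_i)%:P * 'X^i.
Proof.
move=> le_pn; under eq_bigr do rewrite mul_polyC.
by rewrite -poly_def -{1}[p]coefK; apply/polyP => i; rewrite !coef_poly;
  case: ltnP => [/leq_trans->|/(nth_default 0)->] //; rewrite if_same.
Qed.

Let qpoly_sum (q : quaternion {poly K}) n : (qsize q <= n)%N ->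
  q = \sum_(i < n) qmap polyC (qcoef q i) * Quaternion 'X^i 0 0 0.
Proof.
case: q => a b c d; rewrite /qsize !geq_max /= -!andbA => /and4P[la lb lc ld].
rewrite q_sum /=; congr Quaternion; rewrite [LHS](@poly_sum _ n) //;
  by apply: eq_bigr => i _ /=; ring.
Qed.

Lemma dpoly_sum f :
  f = \sum_(i < dsize f) dpolyC (dcoef f i) *d dpow (dpolyX D K) i.
Proof.
under eq_bigr do rewrite dpowX.
case: D f => [f|[q r]]; first exact: qpoly_sum.
rewrite o_sum /dcoef /= -!/(qcoef _ _).
congr Octonion; rewrite [LHS](qpoly_sum (n := maxn (qsize q) (qsize r)))
  ?leq_maxl ?leq_maxr //; apply: eq_bigr => i _ /=.
  by congr Quaternion; rewrite /=; ring.
by congr Quaternion; rewrite /=; ring.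
Qed.

Let dmul0z (z : halg D K) : 0 *d z = 0.
Proof.
case: D z => [z|[q r]] /=; first exact: mul0r.
by rewrite /mulo !(mul0r, mulr0) subr0 addr0.
Qed.

Let dmul1z (z : halg D K) : dscal D 1 *d z = z.
Proof.
case: D z => [[????]|[[????] [????]]] /=; first by congr Quaternion; rewrite /=; ring.
by congr Octonion; congr Quaternion; rewrite /=; ring.
Qed.

Let dmulz1 (z : halg D K) : z *d dscal D 1 = z.
Proof.
case: D z => [[????]|[[????] [????]]] /=; first by congr Quaternion; rewrite /=; ring.
by congr Octonion; congr Quaternion; rewrite /=; ring.
Qed.

Let dcoef_ge f i : (dsize f <= i)%N -> dcoef f i = 0.
Proof.
have qcoef_ge q : (qsize q <= i)%N -> qcoef q i = 0.
  by rewrite /qsize !geq_max -!andbA => /and4P[????]; congr Quaternion;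
    apply: nth_default.
case: D f => [f|[q r]]; first exact: qcoef_ge.
by rewrite /= geq_max => /andP[??]; congr Octonion; apply: qcoef_ge.
Qed.

Let dsize_le f n : (forall i, (n <= i)%N -> dcoef f i = 0) -> (dsize f <= n)%N.
Proof.
case: D f => [[a b c d]|[[a b c d] [a' b' c' d']]] H;
  rewrite /= /qsize !geq_max /= -?andbA;
  by do ?[apply/andP; split]; apply/leq_sizeP => j /H [].
Qed.

Lemma deval_quadratic (B C lam : halg D K) :
  deval (quadratic B C) lam = lam *d lam + B *d lam + C.
Proof.
have cQ i : dcoef (quadratic B C) i = 
  dscal D (i == 2)%:R + (if i == 1 then B else 0) + (if i == 0 then C else 0).
  rewrite /quadratic dpowX.
  have cC (A : halg D K) : dcoef (dpolyC A) i = if i == 0 then A else 0.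
    by case: D A => [[????]|[[????] [????]]]; rewrite /dcoef /dmap /qmap /= !coefC;
      clear; case: i.
  have cCX (A : halg D K) :
      dcoef (dpolyC A *d dpolyX D K) i = if i == 1 then A else 0.
    have -> : dpolyC A *d dpolyX D K = dmap (fun a => a%:P * 'X) A.
      case: D A => [[????]|[[????] [????]]] /=.
        by congr Quaternion; rewrite /=; ring.
      by congr Octonion; congr Quaternion; rewrite /=; ring.
    by case: D A => [[????]|[[????] [????]]]; rewrite /dcoef /dmap /qmap /=
      !coefMX !coefC; clear; case: i => [|[]].
  rewrite -cCX -cC; set u := _ *d _; set v := dpolyC C.
  clearbody u v; rewrite -(coefXn _ 2).
  case: D u v => [[????] [????]|[[????] [????]] [[????] [????]]] /=.
    by congr Quaternion; rewrite /= !coefD ?coef0.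
  by congr Octonion; congr Quaternion; rewrite /= !coefD ?coef0.
have sQ : (dsize (quadratic B C) <= 3)%N.
  by apply: dsize_le => -[|[|[|i]]] // _; rewrite cQ /= !addr0; case: (D).
transitivity (\sum_(i < 3) dcoef (quadratic B C) i *d dpow lam i).
  rewrite /deval (big_ord_widen 3 (fun i => dcoef (quadratic B C) i *d dpow lam i) sQ).
  rewrite big_mkcond; apply: eq_bigr => i _; case: ltnP => // /dcoef_ge->.
  by rewrite dmul0z.
have s0 : dscal D 0 = 0 :> halg D K by case: (D).
rewrite !big_ord_recr big_ord0 /= !cQ /= !s0 !(add0r, addr0).
by rewrite /dpow /= !dmulz1 dmul1z addrC addrA addrAC.
Qed.

End HurwitzPolyTheory.

Section FixedPoints.
Variables (R : realType) (D : hurwitz).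
Implicit Types (f : dpoly D R) (alpha : halg D R).

Definition fixed_point f alpha :=
  forall n : nat, (1 <= n)%N -> deval (dcompn f n) alpha = alpha.

Definition dball alpha (r : R) : set (halg D R) :=
  [set lam | dnorm (lam - alpha) < r].

Definition neighborhood alpha (S : set (halg D R)) :=
  exists2 r : R, 0 < r & dball alpha r `<=` S.

Definition attracting f alpha :=
  fixed_point f alpha /\
  exists S, neighborhood alpha S /\
  exists c : R, 0 < c < 1 /\
  forall lam, (S `\ alpha) lam ->
    dnorm (deval f lam - alpha) < c * dnorm (lam - alpha).

Definition repelling f alpha :=
  fixed_point f alpha /\
  exists S, neighborhood alpha S /\
  exists c : R, 1 < c /\
  forall lam, (S `\ alpha) lam ->
    dnorm (deval f lam - alpha) > c * dnorm (lam - alpha).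

Definition ambivalent f alpha :=
  [/\ fixed_point f alpha, ~ attracting f alpha & ~ repelling f alpha].

End FixedPoints.

(* Main.v *)
Require Import Defs.
From mathcomp Require Import all_boot all_order all_algebra.
From mathcomp Require Import ring lra.
From mathcomp Require Import classical_sets reals.
Import Order.TTheory GRing.Theory Num.Theory.
Local Open Scope ring_scope.

(** Put p = alpha + B, q = alpha, and let P, Q be their imaginary parts. Then
    f(alpha + z) - alpha = L z + z^2 with L z = p z + z q, and
    |L z|^2 = (Re(p + q)^2 + |P|^2 + |Q|^2) |z|^2 + 2 <P z, z Q>.
    Cauchy-Schwarz for the inner product <z, w> = Re(z conj(w)) gives
    m |z| <= |L z| <= M |z|, which settles (1) and (2). For (3), both bounds are
    attained along a line: <P z, z Q> = +-|P| |Q| |z|^2 for z = |Q| P +- |P| Q,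
    or, when that vector vanishes, for any imaginary z orthogonal to P. On such
    a line z^2 is negligible near 0, so the ratio |f(alpha + z) - alpha| / |z|
    is arbitrarily close to M (resp. m). *)

Definition ddot {K : comNzRingType} {D : hurwitz} (z w : halg D K) : K :=
  dcoord1 (z *d dconj w).

(** * Coordinate identities over a commutative ring *)

Section Identities.
Context {K : comNzRingType} {D : hurwitz}.
Implicit Types p q z w : halg D K.

Lemma ddotD z w : ddot (z + w) (z + w) = ddot z z + ddot w w + 2 * ddot z w.
Proof.
case: D z w => [[????] [????]|[[????] [????]] [[????] [????]]];
  by rewrite /ddot /=; ring.
Qed.

Lemma ddotNN z : ddot (- z) (- z) = ddot z z.
Proof. by case: D z => [[????]|[[????] [????]]]; rewrite /ddot /=; ring. Qed.

Lemma ddot_conj z : ddot (dconj z) (dconj z) = ddot z z.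
Proof. by case: D z => [[????]|[[????] [????]]]; rewrite /ddot /=; ring. Qed.

Lemma ddot_scal (t : K) : ddot (dscal D t) (dscal D t) = t ^+ 2.
Proof. by case: D; rewrite /ddot /=; ring. Qed.

(** Euler's four-square identity for quaternions, Degen's eight-square identity for octonions. *)
Lemma ddotMM z w : ddot (z *d w) (z *d w) = ddot z z * ddot w w.
Proof.
case: D z w => [[????] [????]|[[????] [????]] [[????] [????]]];
  by rewrite /ddot /=; ring.
Qed.

Lemma ddot_mul_scaler z w q t : ddot z (w *d (dscal D t *d q)) = t * ddot z (w *d q).
Proof.
case: D z w q => [[????] [????] [????]|
    [[????] [????]] [[????] [????]] [[????] [????]]];
  by rewrite /ddot /=; ring.
Qed.

Lemma dmul_scalN (t : K) z : dscal D (- t) *d z = - (dscal D t *d z).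
Proof.
case: D z => [[????]|[[????] [????]]] /=.
  by congr Quaternion; rewrite /=; ring.
by congr Octonion; congr Quaternion; rewrite /=; ring.
Qed.

Lemma bimul_scale p q z t :
  p *d (dscal D t *d z) + dscal D t *d z *d q = dscal D t *d (p *d z + z *d q).
Proof.
case: D p q z => [[????] [????] [????]|
    [[????] [????]] [[????] [????]] [[????] [????]]] /=.
  by congr Quaternion; rewrite /=; ring.
by congr Octonion; congr Quaternion; rewrite /=; ring.
Qed.

(** With r = Re p + Re q the map is r z + P z + z Q. Since P and Q are imaginary, <z, P z> and <z, z
    Q> vanish, so <P z, z Q> is the only surviving cross term. *)
Lemma ddot_bimul p q z :
  let P := p - dscal D (dcoord1 p) in let Q := q - dscal D (dcoord1 q) in
  ddot (p *d z + z *d q) (p *d z + z *d q) =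
  ((dcoord1 p + dcoord1 q) ^+ 2 + ddot P P + ddot Q Q) * ddot z z
  + 2 * ddot (P *d z) (z *d Q).
Proof.
case: D p q z => [[????] [????] [????]|
    [[????] [????]] [[????] [????]] [[????] [????]]];
  by rewrite /ddot /=; ring.
Qed.

Lemma ddot_comb p q a b : dcoord1 p = 0 -> dcoord1 q = 0 ->
  let z := dscal D b *d p + dscal D a *d q in
  ddot z z = b ^+ 2 * ddot p p + a ^+ 2 * ddot q q - 2 * a * b * dcoord1 (p *d q).
Proof.
case: D p q => [[????] [????]|[[????] [????]] [[????] [????]]] /= -> ->;
  by rewrite /ddot /=; ring.
Qed.

(** Here p^2 = -|p|^2 and q^2 = -|q|^2, so p z = a p q - b |p|^2 and z q = b p q - a |q|^2. *)
Lemma ddot_mul_comb p q a b : dcoord1 p = 0 -> dcoord1 q = 0 ->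
  let z := dscal D b *d p + dscal D a *d q in
  ddot (p *d z) (z *d q) = 2 * a * b * ddot p p * ddot q q
    - (b ^+ 2 * ddot p p + a ^+ 2 * ddot q q) * dcoord1 (p *d q).
Proof.
case: D p q => [[????] [????]|[[????] [????]] [[????] [????]]] /= -> ->;
  by rewrite /ddot /=; ring.
Qed.

(** For imaginary p and w, w p is the conjugate of u = p w, and Re(u^2) = 2 Re(u)^2 - |u|^2. *)
Lemma ddot_mul_swap p w : dcoord1 p = 0 -> dcoord1 w = 0 ->
  ddot (p *d w) (w *d p) = 2 * dcoord1 (p *d w) ^+ 2 - ddot p p * ddot w w.
Proof.
case: D p w => [[????] [????]|[[????] [????]] [[????] [????]]] /= -> ->;
  by rewrite /ddot /=; ring.
Qed.

(** For imaginary p and w, Re(p w) = -<p, w>. A vector w in the first quaternion summand suffices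
    for octonions, as it only meets that component of p. *)
Lemma exists_orthogonal p : dcoord1 p = 0 ->
  exists w, [/\ w != 0, dcoord1 w = 0 & dcoord1 (p *d w) = 0].
Proof.
have H a b c : exists w : quaternion K,
    [/\ w != 0, q_re w = 0 & q_re (Quaternion 0 a b c * w) = 0].
  have [a0|a0] := eqVneq a 0; last first.
    exists (Quaternion 0 b (- a) 0); split=> //=; last by ring.
    by apply/eqP => -[_ /eqP]; rewrite oppr_eq0 (negPf a0).
  exists (Quaternion 0 1 0 0); split=> //=; last by rewrite a0; ring.
  by apply/eqP => -[/eqP]; rewrite oner_eq0.
case: D p => [[? a b c]|[[? a b c] v]] /= ->; have [w [w0 rw pw]] := H a b c.
  by exists w.
exists (Octonion w 0); split=> //=; first by apply: contra w0 => /eqP [->].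
by rewrite -[RHS]pw; case: w v {w0 rw pw} => [????] [????] /=; ring.
Qed.

Lemma deval_quadratic_shift (B C alpha z : halg D K) :
  deval (quadratic B C) (alpha + z) =
  deval (quadratic B C) alpha + ((alpha + B) *d z + z *d alpha + z *d z).
Proof.
rewrite !deval_quadratic.
case: D B C alpha z => [[????] [????] [????] [????]|
    [[????] [????]] [[????] [????]] [[????] [????]] [[????] [????]]] /=.
  by congr Quaternion; rewrite /=; ring.
by congr Octonion; congr Quaternion; rewrite /=; ring.
Qed.

End Identities.

(** * The Euclidean norm and Cauchy-Schwarz *)

Section Norm.
Context {R : realType} {D : hurwitz}.
Implicit Types p q z w : halg D R.

Lemma dcoord1_sqr_le z : dcoord1 z ^+ 2 <= ddot z z.
Proof.
have E (q : quaternion R) : @ddot R Hamilton q q =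
    q_re q ^+ 2 + q_i q ^+ 2 + q_j q ^+ 2 + q_k q ^+ 2.
  by case: q => ????; rewrite /ddot /=; ring.
case: D z => [q|[q v]]; first by rewrite E -!addrA lerDl !addr_ge0 ?sqr_ge0.
have -> : @ddot R Cayley (Octonion q v) (Octonion q v) =
    @ddot R Hamilton q q + @ddot R Hamilton v v.
  by case: q => ????; case: v => ????; rewrite /ddot /=; ring.
by rewrite !E -!addrA lerDl !addr_ge0 ?sqr_ge0.
Qed.

Lemma ddot_ge0 z : 0 <= ddot z z.
Proof. exact: le_trans (sqr_ge0 _) (dcoord1_sqr_le z). Qed.

Lemma ddot_eq0 z : ddot z z = 0 -> z = 0.
Proof.
have E (q : quaternion R) : @ddot R Hamilton q q = 0 -> q = 0.
  case: q => a b c d; rewrite /ddot /= => H.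
  by congr Quaternion; nra.
case: D z => [q|[q v]]; first exact: E.
have -> : @ddot R Cayley (Octonion q v) (Octonion q v) =
    @ddot R Hamilton q q + @ddot R Hamilton v v.
  by case: q => ????; case: v => ????; rewrite /ddot /=; ring.
have ge0 (u : quaternion R) : 0 <= @ddot R Hamilton u u.
  by case: u => ????; rewrite /ddot /=; nra.
by move/eqP; rewrite paddr_eq0 // => /andP[/eqP/E-> /eqP/E->].
Qed.

Lemma sqr_dnorm z : dnorm z ^+ 2 = ddot z z.
Proof. by rewrite sqr_sqrtr ?ddot_ge0. Qed.

Lemma dnorm_ge0 z : 0 <= dnorm z.
Proof. exact: sqrtr_ge0. Qed.

Lemma dnorm0 : dnorm (0 : halg D R) = 0.
Proof.
rewrite -[RHS]sqrtr0; congr Num.sqrt.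
by case: (D); rewrite /=; ring.
Qed.

Lemma dnorm_gt0 z : z != 0 -> 0 < dnorm z.
Proof.
move=> z0; rewrite lt_def dnorm_ge0 andbT; apply: contra z0 => /eqP n0.
by apply/eqP/ddot_eq0; rewrite -sqr_dnorm n0 expr0n.
Qed.

Lemma dnormN z : dnorm (- z) = dnorm z.
Proof. by congr Num.sqrt; apply: ddotNN. Qed.

Lemma dnormM z w : dnorm (z *d w) = dnorm z * dnorm w.
Proof. by rewrite -sqrtrM ?ddot_ge0 //; congr Num.sqrt; apply: ddotMM. Qed.

Lemma dnorm_scal (t : R) : 0 <= t -> dnorm (dscal D t) = t.
Proof.
by move=> t0; rewrite -[RHS]ger0_norm // -sqrtr_sqr -(@ddot_scal R D).
Qed.

(** <z, w> is the real coordinate of z conj(w), an element of norm |z| |w|. *)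
Lemma normr_ddot_le z w : `|ddot z w| <= dnorm z * dnorm w.
Proof.
rewrite -(ler_pXn2r (n := 2)) ?nnegrE ?mulr_ge0 ?dnorm_ge0 //.
rewrite real_normK ?num_real // exprMn !sqr_dnorm -(ddot_conj w) -ddotMM.
exact: dcoord1_sqr_le.
Qed.

Lemma ler_dnormD z w : dnorm (z + w) <= dnorm z + dnorm w.
Proof.
rewrite -(ler_pXn2r (n := 2)) ?nnegrE ?addr_ge0 ?dnorm_ge0 //.
rewrite sqrrD !sqr_dnorm ddotD.
have := le_trans (ler_norm _) (normr_ddot_le z w).
lra.
Qed.

Lemma lerB_dnormD z w : dnorm z - dnorm w <= dnorm (z + w).
Proof. by rewrite lerBlDr -{1}[z](addrK w) (le_trans (ler_dnormD _ _)) ?dnormN. Qed.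

Lemma dReE z : dRe z = dcoord1 z.
Proof.
have -> : dRe z = 2^-1 * (2 * dcoord1 z).
  by congr (_ * _); case: D z => [[????]|[[????] [????]]] /=; ring.
by rewrite mulKf // pnatr_eq0.
Qed.

Lemma dcoord1_dIm z : dcoord1 (dIm z) = 0.
Proof.
rewrite /dIm dReE.
by case: D z => [[????]|[[????] [????]]] /=; rewrite subrr.
Qed.

(** * Extreme gains of the linear map z -> p z + z q *)

Lemma sqr_dnorm_bimul p q z :
  dnorm (p *d z + z *d q) ^+ 2 =
  (dRe (p + q) ^+ 2 + dnorm (dIm p) ^+ 2 + dnorm (dIm q) ^+ 2) * dnorm z ^+ 2
  + 2 * ddot (dIm p *d z) (z *d dIm q).
Proof.
rewrite !sqr_dnorm ddot_bimul /dIm !dReE.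
have -> : dcoord1 (p + q) = dcoord1 p + dcoord1 q by case: D p q => //.
by [].
Qed.

(** [M] is [gain 1] and [m] is [gain (-1)] at p = alpha + B, q = alpha. *)
Definition gain e p q : R :=
  Num.sqrt (dRe (p + q) ^+ 2 + (dnorm (dIm p) + e * dnorm (dIm q)) ^+ 2).

Lemma sqr_gain e p q : gain e p q ^+ 2 =
  dRe (p + q) ^+ 2 + (dnorm (dIm p) + e * dnorm (dIm q)) ^+ 2.
Proof. by rewrite sqr_sqrtr ?addr_ge0 ?sqr_ge0. Qed.

Lemma gain_ge0 e p q : 0 <= gain e p q.
Proof. exact: sqrtr_ge0. Qed.

Lemma normr_ddot_bimul_le p q z :
  `|ddot (p *d z) (z *d q)| <= dnorm p * dnorm q * dnorm z ^+ 2.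
Proof.
have -> : dnorm p * dnorm q * dnorm z ^+ 2 = dnorm (p *d z) * dnorm (z *d q).
  by rewrite !dnormM; ring.
exact: normr_ddot_le.
Qed.

Lemma dnorm_bimul_le p q z : dnorm (p *d z + z *d q) <= gain 1 p q * dnorm z.
Proof.
rewrite -(ler_pXn2r (n := 2)) ?nnegrE ?mulr_ge0 ?gain_ge0 ?dnorm_ge0 //.
rewrite exprMn sqr_gain sqr_dnorm_bimul.
have := le_trans (ler_norm _) (normr_ddot_bimul_le (dIm p) (dIm q) z).
lra.
Qed.

Lemma dnorm_bimul_ge p q z : gain (-1) p q * dnorm z <= dnorm (p *d z + z *d q).
Proof.
rewrite -(ler_pXn2r (n := 2)) ?nnegrE ?mulr_ge0 ?gain_ge0 ?dnorm_ge0 //.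
rewrite exprMn sqr_gain sqr_dnorm_bimul.
have := le_trans (ler_norm _) (normr_ddot_bimul_le (dIm p) (dIm q) z).
have := lerNnormlW (normr_ddot_bimul_le (dIm p) (dIm q) z).
lra.
Qed.

Lemma exists_aligned e p q : e ^+ 2 = 1 -> dcoord1 p = 0 -> dcoord1 q = 0 ->
  exists2 z, z != 0 &
    ddot (p *d z) (z *d q) = e * (dnorm p * dnorm q) * dnorm z ^+ 2.
Proof.
move=> e1 rp rq; set a := dnorm p; set b := dnorm q.
(* This z satisfies |q| (p z) = e |p| (z q), the equality case of Cauchy-Schwarz. *)
pose z := dscal D b *d p + dscal D (e * a) *d q.
have [z0|z0] := eqVneq z 0; last first.
  exists z; rewrite // sqr_dnorm ddot_comb // ddot_mul_comb // -!sqr_dnorm -/a -/b.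
  by rewrite !exprMn e1; ring: e1.
(* Now p and q are linearly dependent: e a q = -b p. As w anticommutes with p, <p w, w p> = -a^2
   |w|^2; dividing <p w, w (e a q)> by e a gives the claim once a is nonzero. *)
have [w [w0 rw pw]] := exists_orthogonal p rp; exists w => //.
have [a0|a0] := eqVneq a 0.
  apply/eqP; rewrite a0 mul0r mulr0 mul0r -normr_le0.
  by apply: le_trans (normr_ddot_bimul_le _ _ _) _; rewrite -/a a0 !mul0r.
have bp : dscal D (e * a) *d q = dscal D (- b) *d p.
  by rewrite dmul_scalN; apply/eqP; rewrite -addr_eq0 addrC -/z z0.
have := ddot_mul_scaler (p *d w) w q (e * a).
rewrite bp ddot_mul_scaler ddot_mul_swap // pw -!sqr_dnorm -/a => H.
have ea0 : e * a != 0 by rewrite mulf_neq0 // -sqrf_eq0 e1 oner_eq0.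
by apply: (mulfI ea0); rewrite -H; ring: e1.
Qed.

(** The map commutes with real scaling, so an aligned vector can be rescaled to any positive norm,
    in particular to arbitrarily small ones. *)
Lemma exists_dnorm_bimul_eq e p q r : e ^+ 2 = 1 -> 0 < r ->
  exists2 z, dnorm z = r & dnorm (p *d z + z *d q) = gain e p q * r.
Proof.
move=> e1 r0.
have [z z0 zE] := exists_aligned e (dIm p) (dIm q) e1 (dcoord1_dIm p) (dcoord1_dIm q).
have nz := dnorm_gt0 z z0.
have L : dnorm (p *d z + z *d q) = gain e p q * dnorm z.
  apply/eqP; rewrite -(eqrXn2 (n := 2)) ?mulr_ge0 ?gain_ge0 ?dnorm_ge0 //.
  by rewrite exprMn sqr_gain sqr_dnorm_bimul zE; apply/eqP; ring: e1.
have t0 : 0 <= r / dnorm z by rewrite divr_ge0 // ltW.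
exists (dscal D (r / dnorm z) *d z).
  by rewrite dnormM dnorm_scal // divfK // gt_eqF.
by rewrite bimul_scale dnormM dnorm_scal // L mulrCA divfK // gt_eqF.
Qed.

End Norm.

(** * Local behaviour of the quadratic at its fixed point *)

Section Quadratic.
Context {R : realType} {D : hurwitz}.
Variables B C alpha : halg D R.
Hypothesis alphaP : fixed_point (quadratic B C) alpha.
Let f := quadratic B C.
Let L z := (alpha + B) *d z + z *d alpha.

Lemma deval_fixed_sub lam (z := lam - alpha) :
  deval f lam - alpha = L z + z *d z.
Proof.
have -> : lam = alpha + z by rewrite subrKC.
by rewrite deval_quadratic_shift (alphaP 1) // addrC addKr.
Qed.

Lemma dnorm_gt0_of_neq (lam : halg D R) : lam <> alpha -> 0 < dnorm (lam - alpha).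
Proof. by move/eqP => n; rewrite dnorm_gt0 // subr_eq0. Qed.

Lemma attracting_of_gain : gain 1 (alpha + B) alpha < 1 -> attracting f alpha.
Proof.
set M := gain _ _ _ => M1; have M0 : 0 <= M by apply: gain_ge0.
(* On this ball M + |z| < (1 + M) / 2, the midpoint of M and 1, which serves as the contraction
   factor. *)
split=> //; exists (dball alpha ((1 - M) / 2)); split.
  by exists ((1 - M) / 2) => //; lra.
exists ((1 + M) / 2); split; first by apply/andP; split; lra.
move=> lam [ball /dnorm_gt0_of_neq n0]; rewrite /dball /= in ball.
rewrite deval_fixed_sub; set z := lam - alpha in n0 ball *.
apply: le_lt_trans (ler_dnormD _ _) _; rewrite dnormM.
by have : dnorm (L z) <= M * dnorm z := dnorm_bimul_le _ _ z; nra.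
Qed.

Lemma repelling_of_gain : 1 < gain (-1) (alpha + B) alpha -> repelling f alpha.
Proof.
set m := gain _ _ _ => m1.
(* On this ball m - |z| > (1 + m) / 2, the expansion factor. *)
split=> //; exists (dball alpha ((m - 1) / 2)); split.
  by exists ((m - 1) / 2) => //; lra.
exists ((1 + m) / 2); split; first by lra.
move=> lam [ball /dnorm_gt0_of_neq n0]; rewrite /dball /= in ball.
rewrite deval_fixed_sub; set z := lam - alpha in n0 ball *.
apply: lt_le_trans (lerB_dnormD _ _); rewrite dnormM.
by have : m * dnorm z <= dnorm (L z) := dnorm_bimul_ge _ _ z; nra.
Qed.

Lemma shift_in_neighborhood S r z :
  (dball alpha r `<=` S)%classic -> dnorm z < r -> 0 < dnorm z ->
  (S `\ alpha)%classic (alpha + z).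
Proof.
move=> rS zr z0; split; first by apply: rS; rewrite /dball /= addrC addKr.
by move=> /= /(canRL (addKr _)) zE; rewrite zE addNr dnorm0 ltxx in z0.
Qed.

Lemma not_attracting : 1 <= gain 1 (alpha + B) alpha -> ~ attracting f alpha.
Proof.
move=> M1 [_ [S [[r r0 rS] [c [/andP[c0 c1] H]]]]].
(* The bound r / 2 keeps z inside the ball; s <= 1 - c gives M - s >= c, contradicting strict
   contraction by c. *)
pose s := Num.min (r / 2) (1 - c).
have s0 : 0 < s by rewrite lt_min; apply/andP; split; lra.
have sr : s <= r / 2 by rewrite ge_min lexx.
have sc : s <= 1 - c by rewrite ge_min lexx orbT.
have [z zs Lz] := exists_dnorm_bimul_eq 1 (alpha + B) alpha s (expr1n _ _) s0.
have zr : dnorm z < r by lra.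
have zgt0 : 0 < dnorm z by lra.
have := H _ (shift_in_neighborhood S r z rS zr zgt0).
rewrite deval_fixed_sub (addrC alpha) addrK; apply/negP; rewrite -leNgt.
apply: le_trans (lerB_dnormD _ _); rewrite Lz dnormM zs; nra.
Qed.

Lemma not_repelling : gain (-1) (alpha + B) alpha <= 1 -> ~ repelling f alpha.
Proof.
move=> m1 [_ [S [[r r0 rS] [c [c1 H]]]]].
(* Here s <= c - 1 gives m + s <= c, contradicting strict expansion by c. *)
pose s := Num.min (r / 2) (c - 1).
have s0 : 0 < s by rewrite lt_min; apply/andP; split; lra.
have sr : s <= r / 2 by rewrite ge_min lexx.
have sc : s <= c - 1 by rewrite ge_min lexx orbT.
have [z zs Lz] := exists_dnorm_bimul_eq (-1) (alpha + B) alpha s (sqrr_sign R 1) s0.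
have zr : dnorm z < r by lra.
have zgt0 : 0 < dnorm z by lra.
have := H _ (shift_in_neighborhood S r z rS zr zgt0).
rewrite deval_fixed_sub (addrC alpha) addrK; apply/negP; rewrite -leNgt.
apply: le_trans (ler_dnormD _ _) _; rewrite Lz dnormM zs; nra.
Qed.

End Quadratic.

Theorem theorem5p1 (R : realType) (D : hurwitz) (B C alpha : halg D R) :
  let f := quadratic B C in
  let M := Num.sqrt (dRe (alpha *+ 2 + B) ^+ 2 +
             (dnorm (dIm (alpha + B)) + dnorm (dIm alpha)) ^+ 2) in
  let m := Num.sqrt (dRe (alpha *+ 2 + B) ^+ 2 +
             (dnorm (dIm (alpha + B)) - dnorm (dIm alpha)) ^+ 2) in
  fixed_point f alpha ->
  [/\ M < 1 -> attracting f alpha,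
      1 < m -> repelling f alpha
    & m <= 1 -> 1 <= M -> ambivalent f alpha].
Proof.
move=> f M m fix_alpha.
have sE : alpha *+ 2 + B = alpha + B + alpha by rewrite mulr2n addrAC.
have -> : M = gain 1 (alpha + B) alpha by rewrite /M /gain sE mul1r.
have -> : m = gain (-1) (alpha + B) alpha by rewrite /m /gain sE mulN1r.
split; [exact: attracting_of_gain | exact: repelling_of_gain |].
by move=> m1 M1; split=> //; [exact: not_attracting | exact: not_repelling].
Qed.
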